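(* Let $X$ be a random vector in $\mathbb{R}^d$ and let $F:\mathbb{R}^d\to\mathbb{R}$ be a measurable function such that $F(X)$ has a finite absolute moment of some order at least $1$. Consider couplings $(X,Y)$, where $Y$ is a real random variable, possibly dependent on $X$, such that $(Y)_+$ has a finite moment of some order at least $1$; such a coupling is specified by the conditional distribution $\mathbb{P}(Y\mid X)$. Define $$\nu\left(\mathbb{P}(Y\mid X)\right)=\sup_{x\in\mathrm{ess\,supp}(X)}\frac{1}{\mathbb{P}\left(Y\ge F(X)\mid X=x\right)}\in[1,\infty].$$ Then: (i) For any $p\ge1$ such that $F(X)$ has a finite absolute moment of order $p$, $$\left(\mathbb{E}\left((F(X))_+^p\right)\right)^{1/p}=\inf_{\mathbb{P}(Y\mid X)}\left(\mathbb{E}\left((Y)_+^p\right)\right)^{1/p}\nu^{1/p}\left(\mathbb{P}(Y\mid X)\right).$$ (ii) For any $t\ge0$, with probability at least $1-e^{-t}$, $$F(X)\le\inf_{\mathbb{P}(Y\mid X),\ b\in\mathbb{R},\ p\ge1}\ b+e^{t/p}\left(\mathbb{E}\left((Y-b)_+^p\right)\right)^{1/p}\nu^{1/p}\left(\mathbb{P}(Y\mid X)\right).$$ (iii) For any such coupling and any $s\in\mathbb{R}$, $$\mathbb{P}\left(F(X)\ge s\right)\le\nu\left(\mathbb{P}(Y\mid X)\right)\,\mathbb{P}(Y\ge s).$$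
   Context: $(z)_+=\max\{z,0\}$ and $(z)_+^p=((z)_+)^p$. The infima run over all conditional distributions (Markov kernels from $\mathbb{R}^d$ to $\mathbb{R}$) $\mathbb{P}(Y\mid X)$ defining couplings as in the claim; for a kernel $x\mapsto K_x$, $\mathbb{P}(Y\ge F(X)\mid X=x)=K_x([F(x),\infty))$. $\mathrm{ess\,supp}(X)$ is the (essential) support of the law of $X$, the smallest closed set of full probability. Expectations of nonnegative variables take values in $[0,\infty]$, with conventions $1/0=\infty$ and $0\cdot\infty=\infty$ (bounds with $\nu=\infty$ are vacuous). *)

(* Defs.v *)
From HB Require Import structures.
From mathcomp Require Import all_boot all_order all_algebra.
From mathcomp Require Import all_classical all_reals all_analysis.

Set Implicit Arguments.
Unset Strict Implicit.
Unset Printing Implicit Defensive.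
Import Order.TTheory GRing.Theory Num.Theory.
Import numFieldNormedType.Exports.
Local Open Scope classical_set_scope.
Local Open Scope ring_scope.
Local Open Scope ereal_scope.

(* R^d with its Borel sigma-algebra. *)
Notation Rvec R d := (g_sigma_algebraType (@open 'rV[R]_d)).

(* Markov kernels from R^d to R, i.e. conditional distributions P(Y | X). *)
Notation cond_distr R d := (R.-pker Rvec R d ~> measurableTypeR R).

Definition ess_supp (R : realType) (d : nat) (mu : probability (Rvec R d) R) :
  set 'rV[R]_d :=
  \bigcap_(C in [set C : set 'rV[R]_d | closed C /\ mu C = 1]) C.

Section joint_law.
Context (R : realType) (d : nat).
Variables (mu : probability (Rvec R d) R) (K : cond_distr R d).

Let mu_ker := kprobability
  (measurable_cst (mu : pprobability (Rvec R d) R)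
    : measurable_fun [set: unit] _).

(* The law of (X, Y) when X has law [mu] and Y has conditional law [K x] given
   X = x (see [joint_lawE]).  The kernels of [mkproduct] take an additional
   parameter, which is here a dummy point of [unit]; [kernel_snd] discards it. *)
Definition joint_law : set (Rvec R d * measurableTypeR R) -> \bar R :=
  mkproduct mu_ker (kernel.kernel_snd K) tt.

Lemma joint_lawE (A : set (Rvec R d * measurableTypeR R)) :
  measurable A -> joint_law A = \int[mu]_x K x (xsection A x).
Proof.
move=> mA; rewrite /joint_law /mkproduct /kproduct.
by apply: eq_integral => x _; rewrite kernel.intker_indicE.
Qed.

HB.instance Definition _ := Measure.copy joint_law
  (mkproduct mu_ker (kernel.kernel_snd K) tt).

Let joint_law_setT : joint_law [set: _] = 1.
Proof.
rewrite joint_lawE// (eq_integral (cst 1)) ?integral_cst//=.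
  by rewrite mul1e probability_setT.
move=> x _; rewrite xsectionE -[LHS]/(K x [set: _]).
exact: prob_kernel.
Qed.

HB.instance Definition _ :=
  Measure_isProbability.Build _ _ _ joint_law joint_law_setT.

End joint_law.

(* The product of nonnegative extended reals with the convention
   0 * +oo = +oo, whereas the library has 0 * +oo = 0. *)
Definition mule_top (R : realType) (x y : \bar R) : \bar R :=
  if (x == +oo) || (y == +oo) then +oo else x * y.

(* E((Y - b)_+^p). *)
Definition pos_moment (R : realType) (d : nat) (mu : probability (Rvec R d) R)
    (K : cond_distr R d) (b p : R) : \bar R :=
  'E_(joint_law mu K)[fun xy => ((Num.max (xy.2 - b) 0) `^ p)%R].

Definition admissible (R : realType) (d : nat) (mu : probability (Rvec R d) R)
    (K : cond_distr R d) : Prop :=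
  exists2 q : R, (1 <= q)%R & pos_moment mu K 0 q < +oo.

(* In [\bar R], the inverse of 0 is +oo. *)
Definition nu (R : realType) (d : nat) (mu : probability (Rvec R d) R)
    (F : Rvec R d -> R) (K : cond_distr R d) : \bar R :=
  ereal_sup [set (K x [set y | (F x <= y)%R])^-1 | x in ess_supp mu].

(* Main.v *)
Require Import Defs.
From HB Require Import structures.
From mathcomp Require Import all_boot all_order all_algebra.
From mathcomp Require Import all_classical all_reals all_analysis.
From mathcomp Require Import measurable_realfun lra.
Set Implicit Arguments.
Unset Strict Implicit.
Unset Printing Implicit Defensive.
Import Order.TTheory GRing.Theory Num.Theory.
Import numFieldNormedType.Exports.
Local Open Scope classical_set_scope.
Local Open Scope ring_scope.
Local Open Scope ereal_scope.

(* On the support of mu := law of X, 1 <= nu K x [F x, +oo[; since the support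
   has full measure, mu is dominated by nu times the law of X restricted to the
   event F X <= Y.  Integrating 1_(F >= s) gives (iii), and integrating
   (F - b)_+^p gives E (F X - b)_+^p <= nu E (Y - b)_+^p.  The choice Y = F X
   attains equality in (i).  By Markov's inequality every candidate bound v in
   (ii) satisfies P (v < F X) <= exp (- t), and this passes to the infimum by
   continuity from below. *)

(** * Topology of $\mathbb{R}^d$ and the support of a law *)

Lemma rat_ball_nbhs (R : realType) (d : nat) (x : 'rV[R]_d)
    (U : set 'rV[R]_d) : nbhs x U ->
  exists2 qn : 'rV[rat]_d * nat,
    (ball (map_mx ratr qn.1 : 'rV[R]_d) qn.2.+1%:R^-1)%R° x &
    (ball (map_mx ratr qn.1 : 'rV[R]_d) qn.2.+1%:R^-1)%R `<=` U.
Proof.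
move=> /nbhs_ballP[e /= e0 xeU].
(* With [r < e / 2] and a rational centre [q] within [r / 2] of [x], the ball of radius [r] at [q]
   contains the ball of radius [r / 2] at [x] and lies in the ball of radius [3 r / 2 < e] at
   [x]. *)
have [n ne] : exists n, (n.+1%:R^-1 < e / 2 :> R)%R.
  have e2 : (0 < e / 2)%R by rewrite divr_gt0.
  have [n _ /(_ n (leqnn n))] := near_infty_natSinv_lt (PosNum e2).
  by exists n.
set r : R := (n.+1%:R^-1)%R.
have r20 : (0 < r / 2)%R by rewrite divr_gt0// invr_gt0.
have q_ j : {q : rat | ball (x ord0 j) (r / 2)%R (ratr q : R)}.
  apply: cid.
  have /rat_in_itvoo[q] : (x ord0 j - r / 2 < x ord0 j + r / 2 :> R)%R.
    by rewrite ltrBlDr -addrA ltrDl addr_gt0.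
  rewrite in_itv/= => qx.
  by exists q; rewrite -[ball]/(ball_ Num.norm) /= ltr_distlC.
pose q : 'rV[rat]_d := (\row_j sval (q_ j))%R.
have xq : ball x (r / 2)%R (map_mx ratr q : 'rV[R]_d).
  by split => // i j; rewrite (ord1 i) !mxE; exact: (svalP (q_ j)).
exists (q, n) => /=; rewrite -/r.
  apply/nbhs_ballP; exists (r / 2)%R => //= y xy.
  by rewrite (splitr r); exact: ball_triangle (ball_sym xq) xy.
move=> y qy; apply: xeU.
apply: (@le_ball _ _ _ (r / 2 + r)%R); last exact: ball_triangle xq qy.
have : (r / 2 <= r)%R by rewrite ler_pdivrMr// ler_peMr ?invr_ge0// ler1n.
by move: ne; rewrite -/r; lra.
Qed.

Lemma closed_ess_supp (R : realType) (d : nat) (mu : probability (Rvec R d) R) :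
  closed (ess_supp mu).
Proof. by apply: closed_bigI => C []. Qed.

Lemma open_measurable_Rvec (R : realType) (d : nat) (U : set 'rV[R]_d) :
  open U -> measurable (U : set (Rvec R d)).
Proof. by move=> oU; exact: sub_sigma_algebra. Qed.

Lemma closed_measurable_Rvec (R : realType) (d : nat) (C : set 'rV[R]_d) :
  closed C -> measurable (C : set (Rvec R d)).
Proof.
move=> cC; rewrite -(setCK C); apply: measurableC.
by apply: open_measurable_Rvec; exact: closed_openC.
Qed.

(** The complement of the support is a possibly uncountable union of open null sets. Each of its
    points lies in the interior of a rational ball contained in one of them, and there are only
    countably many such balls. *)
Lemma ess_suppC_eq0 (R : realType) (d : nat) (mu : probability (Rvec R d) R) :
  mu (~` ess_supp mu) = 0.
Proof.
pose B (k : 'rV[rat]_d * nat) : set 'rV[R]_d :=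
  ((ball (map_mx ratr k.1 : 'rV[R]_d) k.2.+1%:R^-1)%R)°.
(* Enumerates the null rational balls; integers that code no ball, or a ball of positive measure,
   contribute the empty set. *)
pose N n : set (Rvec R d) :=
  if unpickle n is Some k then if mu (B k) == 0 then B k else set0 else set0.
have mN n : measurable (N n).
  rewrite /N; case: unpickle => [k|//]; case: ifP => // _.
  by apply: open_measurable_Rvec; exact: open_interior.
have N0 n : mu (N n) = 0.
  by rewrite /N; case: unpickle => [k|//]; case: ifPn => [/eqP//|].
have mE : measurable (~` ess_supp mu : set (Rvec R d)).
  by apply: open_measurable_Rvec; apply: closed_openC; exact: closed_ess_supp.
apply/negligibleP => //.
have : mu.-negligible (\bigcup_n N n).
  by apply: negligible_bigcup => n; apply/negligibleP; [exact: mN|exact: N0].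
apply: negligibleS.
move=> x; rewrite /ess_supp setC_bigcap => -[C [cC muC]] Cx.
have [k kx kC] : exists2 k, B k x &
    (ball (map_mx ratr k.1 : 'rV[R]_d) k.2.+1%:R^-1)%R `<=` ~` C.
  apply: rat_ball_nbhs; apply: open_nbhs_nbhs; split => //.
  exact: closed_openC.
exists (pickle k) => //; rewrite /N pickleK ifT//.
have mC := closed_measurable_Rvec cC.
rewrite -measure_le0 (@le_trans _ _ (mu (~` C)))//.
  rewrite le_measure ?inE//.
  - by apply: open_measurable_Rvec; exact: open_interior.
  - exact: measurableC.
  - by apply: subset_trans kC; exact: interior_subset.
by rewrite probability_setC// muC subee.
Qed.

(** Keeps the supremum defining [nu] from being taken over the empty set, where it would be
    [-oo]. *)
Lemma ess_supp_neq0 (R : realType) (d : nat) (mu : probability (Rvec R d) R) :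
  ess_supp mu !=set0.
Proof.
apply/set0P/negP => /eqP E0; have := ess_suppC_eq0 mu.
rewrite E0 setC0 => mu0; have := probability_setT mu.
by move/esym/eqP; rewrite [X in _ == X]mu0 onee_eq0.
Qed.

(** * Values and bounds of [nu] *)

Lemma nu_kdirac (R : realType) (d : nat) (mu : probability (Rvec R d) R)
    (F : Rvec R d -> R) (mF : measurable_fun [set: Rvec R d] F) :
  nu mu F (kdirac (Y := measurableTypeR R) mF : cond_distr R d) = 1.
Proof.
rewrite /nu (_ : [set _ | x in _] = [set 1]) ?ereal_sup1//.
have diracE x : kdirac mF x [set y | (F x <= y)%R] = 1.
  by rewrite /kdirac/= diracE mem_set/=.
apply/seteqP; split => [_ [x _ <-]|_ ->] /=; first by rewrite diracE inve1.
by have [x ?] := ess_supp_neq0 mu; exists x => //; rewrite diracE inve1.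
Qed.

Lemma nu_ge1 (R : realType) (d : nat) (mu : probability (Rvec R d) R)
    (F : Rvec R d -> R) (K : cond_distr R d) : 1 <= nu mu F K.
Proof.
have [x sx] := ess_supp_neq0 mu.
apply: (@le_trans _ _ (K x [set y | (F x <= y)%R])^-1); last first.
  by apply: ereal_sup_ubound; exists x.
have mI : measurable ([set y | (F x <= y)%R] : set (measurableTypeR R)).
  rewrite (_ : [set _ | _] = [set` `[F x, +oo[])//.
  by apply/seteqP; split => y /=; rewrite in_itv/= andbT.
have : K x [set y | (F x <= y)%R] <= 1.
  by rewrite -(@prob_kernel _ _ _ _ _ K x) le_measure ?inE.
have : 0 <= K x [set y | (F x <= y)%R] by [].
case: (K x _) => [r| |]//; rewrite !lee_fin => r0 r1; rewrite inver.
case: ifPn => [_|rN0]; first by rewrite leey.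
by rewrite lee_fin invf_ge1// lt_neqAle eq_sym rN0.
Qed.

(** A finite [nu] excludes a null half-line, whose inverse would be [+oo], so the denominator can be
    cleared. *)
Lemma ess_supp_nu_ge1 (R : realType) (d : nat) (mu : probability (Rvec R d) R)
    (F : Rvec R d -> R) (K : cond_distr R d) (x : Rvec R d) :
  ess_supp mu x -> nu mu F K < +oo ->
  1 <= nu mu F K * K x [set y | (F x <= y)%R].
Proof.
move=> sx nuoo.
have le_nu : (K x [set y | (F x <= y)%R])^-1 <= nu mu F K.
  by apply: ereal_sup_ubound; exists x.
have := nu_ge1 mu F K.
move: nuoo le_nu; case: (nu _ _ _) => [n| |]// _.
have : 0 <= K x [set y | (F x <= y)%R] by [].
case: (K x _) => [r| |]//; last first.
  by move=> _ _ n1; rewrite gt0_muley ?leey// (lt_le_trans _ n1).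
rewrite inver lee_fin => r0; case: ifPn => // rN0.
have {rN0}r0' : (0 < r)%R by rewrite lt_neqAle eq_sym rN0.
by rewrite lee_fin -EFinM lee_fin -[(r^-1)%R]mul1r ler_pdivrMr.
Qed.

(** * Domination of the law of [X] by the joint law *)

Lemma measurable_epigraph (R : realType) (d : nat) (F : Rvec R d -> R) :
  measurable_fun [set: Rvec R d] F ->
  measurable ([set xy | (F xy.1 <= xy.2)%R] :
    set (Rvec R d * measurableTypeR R)).
Proof.
move=> mF; rewrite -[X in measurable X]setTI.
by apply: measurable_fun_le => //; exact: measurableT_comp.
Qed.

(** Both sides are integrals against [mu], and the integrands compare at every point of the support,
    hence almost everywhere. *)
Lemma measure_le_nu_joint_law (R : realType) (d : nat)
    (mu : probability (Rvec R d) R) (F : Rvec R d -> R)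
    (mF : measurable_fun [set: Rvec R d] F) (K : cond_distr R d)
    (A : set (Rvec R d)) : measurable A -> nu mu F K < +oo ->
  mu A <= nu mu F K *
    joint_law mu K (fst @^-1` A `&` [set xy | (F xy.1 <= xy.2)%R]).
Proof.
move=> mA nuoo; set S : set (Rvec R d * measurableTypeR R) := _ `&` _.
have mS : measurable S.
  apply: measurableI; last exact: measurable_epigraph.
  by rewrite -[X in measurable X]setTI; exact: measurable_fst.
have nu0 : 0 <= nu mu F K := le_trans lee01 (nu_ge1 mu F K).
have mK := measurable_fun_xsection_finite_kernel K (mem_set mS).
rewrite joint_lawE// -ge0_integralZl// -(setIT A) -integral_indic//.
apply: ae_ge0_le_integral => //.
- by apply/measurable_EFinP; exact: measurable_indic.
- by move=> x _; rewrite mule_ge0.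
- exact: measurable_funeM.
exists (~` ess_supp mu); split.
- by apply: open_measurable_Rvec; apply: closed_openC; exact: closed_ess_supp.
- exact: ess_suppC_eq0.
move=> x /= + sx; apply => _; rewrite indicE.
case: (boolP (x \in A)) => [/set_mem Ax|_]; last by rewrite mule_ge0.
(* For [x] in [A], the section of [S] is the half-line that appears in [nu]. *)
rewrite (_ : xsection S x = [set y | (F x <= y)%R]) ?ess_supp_nu_ge1//.
by rewrite xsectionE; apply/seteqP; split => [y []//|y Fxy]; split.
Qed.

Lemma integral_mrestr (disp : measure_display) (T : measurableType disp)
    (R : realType) (m : {measure set T -> \bar R}) (D : set T)
    (mD : measurable D) (f : T -> \bar R) :
  (forall x, 0 <= f x) -> measurable_fun [set: T] f ->
  \int[mrestr m mD]_x f x = \int[m]_(x in D) f x.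
Proof.
move=> f0 mf; rewrite [LHS](@ge0_negligible_integral _ _ _ _ _ (~` D))//.
- rewrite setTD setCK; apply: eq_measure_integral => A mA AD.
  by rewrite /= /mrestr setIidl.
- exact: measurableC.
- by rewrite /= /mrestr setICl measure0.
Qed.

(** The hypothesis says that [m2] is at most [n] times the image under [phi] of [m1] restricted to
    [S]; the integral of a nonnegative function is monotone in the measure. *)
Lemma ge0_integral_le_preimage (d1 d2 : measure_display)
    (T1 : measurableType d1) (T2 : measurableType d2) (R : realType)
    (m1 : {measure set T1 -> \bar R}) (m2 : {measure set T2 -> \bar R})
    (phi : T1 -> T2) (mphi : measurable_fun [set: T1] phi)
    (S : set T1) (mS : measurable S) (n : {nonneg R}) (g : T2 -> \bar R) :
  (forall A, measurable A -> m2 A <= n%:num%:E * m1 (phi @^-1` A `&` S)) ->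
  (forall y, 0 <= g y) -> measurable_fun [set: T2] g ->
  \int[m2]_y g y <= n%:num%:E * \int[m1]_(x in S) g (phi x).
Proof.
move=> m12 g0 mg.
pose m_ : {measure set T2 -> \bar R} := pushforward (mrestr m1 mS) phi.
pose m := m_ mphi.
have mE : \int[m]_y g y = \int[m1]_(x in S) g (phi x).
  rewrite ge0_integral_pushforward// preimage_setT integral_mrestr//=.
  exact: measurableT_comp.
rewrite -mE -ge0_integral_mscale//.
exact: ge0_le_measure_integral.
Qed.

Lemma ge0_integral_le_nu (R : realType) (d : nat)
    (mu : probability (Rvec R d) R) (F : Rvec R d -> R)
    (mF : measurable_fun [set: Rvec R d] F) (K : cond_distr R d)
    (g : Rvec R d -> \bar R) :
  nu mu F K < +oo -> (forall x, 0 <= g x) ->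
  measurable_fun [set: Rvec R d] g ->
  \int[mu]_x g x <= nu mu F K *
    \int[joint_law mu K]_(xy in [set xy | (F xy.1 <= xy.2)%R]) g xy.1.
Proof.
move=> nuoo g0 mg.
have mS := measurable_epigraph mF.
have := measure_le_nu_joint_law (mu := mu) mF (K := K) _ nuoo.
have := nu_ge1 mu F K; move: nuoo; case: (nu mu F K) => [n| |]// _.
rewrite lee_fin => n1 le_n.
have n0 : (0 <= n)%R := le_trans ler01 n1.
exact: (ge0_integral_le_preimage (m1 := joint_law mu K) (m2 := mu)
  (n := NngNum n0) measurable_fst mS le_n g0 mg).
Qed.

(** * Moments of positive parts *)

Lemma measurable_pos_part (R : realType) (d : measure_display)
    (T : measurableType d) (f : T -> R) (b p : R) :
  measurable_fun [set: T] f ->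
  measurable_fun [set: T] (fun x => (Num.max (f x - b) 0 `^ p)%R%:E).
Proof.
move=> mf; apply/measurable_EFinP.
apply: (measurableT_comp (measurable_powR p)).
by apply: measurable_maxr => //; exact: measurable_funB.
Qed.

Lemma pos_moment_ge (R : realType) (d : nat)
    (mu : probability (Rvec R d) R) (F : Rvec R d -> R)
    (mF : measurable_fun [set: Rvec R d] F) (K : cond_distr R d) (b p : R) :
  (0 <= p)%R ->
  \int[mu]_x ((Num.max (F x - b) 0 `^ p)%R)%:E <=
    mule_top (pos_moment mu K b p) (nu mu F K).
Proof.
move=> p0; rewrite /mule_top; case: ifPn => [_|]; first by rewrite leey.
rewrite negb_or => /andP[_ nuoo].
apply: (le_trans (ge0_integral_le_nu (K := K) mF _ _ _)).
- by rewrite lt_neqAle nuoo leey.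
- by move=> x; rewrite lee_fin powR_ge0.
- exact: measurable_pos_part.
rewrite muleC lee_wpmul2r ?(le_trans lee01 (nu_ge1 _ _ _))// /pos_moment unlock.
have mS := measurable_epigraph mF.
(* First replace [F X] by the larger [Y] on the event [F X <= Y], then extend the integral to the
   whole space. *)
apply: (@le_trans _ _
    (\int[joint_law mu K]_(xy in [set xy | (F xy.1 <= xy.2)%R])
      (Num.max (xy.2 - b) 0 `^ p)%R%:E)).
  apply: ge0_le_integral => //.
  - by move=> x _; rewrite lee_fin powR_ge0.
  - apply: measurable_funTS; apply: (@measurable_pos_part _ _ _ (F \o fst)).
    exact: measurableT_comp.
  - by apply: measurable_funTS; exact: measurable_pos_part.
  - move=> xy /= Fxy; rewrite lee_fin.
    apply: ge0_ler_powR => //; rewrite ?nnegrE ?le_max ?lexx ?orbT//.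
    by rewrite -!le_max ge_max !le_max lerB//= lexx orbT.
apply: ge0_subset_integral => //; first exact: measurable_pos_part.
by move=> x _; rewrite lee_fin powR_ge0.
Qed.

Lemma pos_moment_kdirac (R : realType) (d : nat)
    (mu : probability (Rvec R d) R) (F : Rvec R d -> R)
    (mF : measurable_fun [set: Rvec R d] F) (b p : R) :
  pos_moment mu (kdirac (Y := measurableTypeR R) mF : cond_distr R d) b p =
  \int[mu]_x ((Num.max (F x - b) 0 `^ p)%R)%:E.
Proof.
pose h (x : Rvec R d) : Rvec R d * measurableTypeR R := (x, F x).
have mh : measurable_fun [set: Rvec R d] h by exact: measurable_fun_pair.
rewrite /pos_moment unlock.
(* For [Y = F X] the joint law is the image of [mu] under the graph map [h]. *)
rewrite (eq_measure_integral (pushforward mu h)); last first.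
  move=> A mA _; rewrite [LHS]joint_lawE//.
  have mhA : measurable (h @^-1` A).
    by rewrite -[X in measurable X]setTI; exact: mh.
  rewrite [RHS](_ : _ = mu (h @^-1` A `&` setT)); last by rewrite setIT.
  rewrite -integral_indic//.
  apply: eq_integral => x _; rewrite /kdirac/= diracE indicE.
  by rewrite mem_xsection.
rewrite ge0_integral_pushforward//; first exact: measurable_pos_part.
by move=> x _; rewrite lee_fin powR_ge0.
Qed.

(** A positive power is infinite exactly when its base is, so the convention for [+oo] applies on
    both sides at once. *)
Lemma mule_top_poweR (R : realType) (x y : \bar R) (r : R) :
  (0 < r)%R -> 0 <= x -> 0 <= y ->
  mule_top (x `^ r) (y `^ r) = mule_top x y `^ r.
Proof.
move=> r0 x0 y0; have rN0 : r != 0%R by rewrite gt_eqF.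
rewrite /mule_top.
have eqy z : (z `^ r == +oo) = (z == +oo).
  by apply/eqP/eqP => [/poweR_eqy//|->]; rewrite poweRyr.
by rewrite !eqy; case: ifP => _; [rewrite poweRyr|rewrite poweRM].
Qed.

Lemma mule_topx1 (R : realType) (x : \bar R) : mule_top x 1 = x.
Proof. by rewrite /mule_top orbF mule1; case: eqP. Qed.

(** * Tail bounds and their passage to an infimum *)

Lemma measure_ereal_inf_lt (disp : measure_display) (T : measurableType disp)
    (R : realType) (P : {measure set T -> \bar R}) (f : T -> \bar R)
    (S : set (\bar R)) (a : \bar R) :
  measurable_fun [set: T] f -> 0 <= a ->
  (forall v, S v -> P [set x | v < f x] <= a) ->
  P [set x | ereal_inf S < f x] <= a.
Proof.
move=> mf a0 Sa.
have [->|S0] := eqVneq S set0.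
  rewrite ereal_inf0 (_ : [set _ | _] = set0) ?measure0//.
  by rewrite -subset0 => x /=; rewrite ltNge leey.
have [u Su ucvg] := ereal_inf_seq S0.
(* Running minima of a minimizing sequence: they decrease, so the events [v n < f x] increase.
   Taking [n.+1] terms avoids the empty minimum [+oo] and keeps [v n] in [S]. *)
pose v n := \big[mine/+oo]_(i < n.+1) u i.
have Sv n : S (v n).
  rewrite /v; elim: n => [|n IH].
    by rewrite big_ord_recr big_ord0/= minye.
  by rewrite big_ord_recr/= minEle; case: ifP.
have v_le n i : (i <= n)%N -> v n <= u i.
  by move=> ni; rewrite /v (bigD1 (Ordinal (ni : (i < n.+1)%N)))//= ge_min lexx.
have mA n : measurable [set x | v n < f x].
  by rewrite -[X in measurable X]setTI; exact: emeasurable_fun_o_infty.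
have AE : [set x | ereal_inf S < f x] = \bigcup_n [set x | v n < f x].
  apply/seteqP; split => [x /= Sx|x [n _ /=]]; last first.
    by apply: le_lt_trans; exact: ereal_inf_lbound.
  have [n _ /(_ n (leqnn n)) /= un] := ucvg _ (open_ereal_lt' Sx).
  by exists n => //=; exact: le_lt_trans (v_le _ _ (leqnn n)) un.
have ndA : nondecreasing_seq (fun n => [set x | v n < f x]).
  apply/nondecreasing_seqP => n; apply/subsetPset => x /=.
  by apply: le_lt_trans; rewrite /v big_ord_recr/= ge_min lexx.
have := @nondecreasing_cvg_mu _ _ _ P _ mA (bigcupT_measurable _ mA) ndA.
rewrite AE => /cvg_lim <- //.
apply: lime_le; last by apply: nearW => n /=; exact: Sa.
apply: ereal_nondecreasing_is_cvgn => m n mn.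
rewrite le_measure ?inE//; exact/subsetPset/ndA.
Qed.

(** Markov's inequality for the [p]-th power of the positive part at level [expR t * v]. If [v] is
    [+oo], the event is empty. *)
Lemma measure_gt_pos_part (disp : measure_display) (T : measurableType disp)
    (R : realType) (P : {measure set T -> \bar R}) (f : T -> R)
    (b p t : R) (v : \bar R) :
  measurable_fun [set: T] f -> (0 < p)%R ->
  \int[P]_x ((Num.max (f x - b) 0 `^ p)%R)%:E <= v ->
  P [set x | b%:E + (expR (t / p))%:E * v `^ (p^-1)%R < (f x)%:E] <=
    (expR (- t))%:E.
Proof.
move=> mf p0; have pV : (p^-1 != 0)%R by rewrite invr_neq0 ?gt_eqF.
set g := fun x => ((Num.max (f x - b) 0 `^ p)%R)%:E => gv.
have g0 x : 0 <= g x by rewrite lee_fin powR_ge0.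
have mg : measurable_fun [set: T] g by exact: measurable_pos_part.
have v0 : 0 <= v by apply: le_trans gv; apply: integral_ge0 => x _; exact: g0.
move: v0 gv; case: v => [r| |]//; last first.
  move=> _ _; rewrite (_ : [set _ | _] = set0) ?measure0 ?lee_fin ?expR_ge0//.
  rewrite poweRyr// gt0_muley ?lte_fin ?expR_gt0//=.
  by rewrite -subset0 => x /=; rewrite ltNge leey.
rewrite lee_fin => r0 gv; set A := [set x | _].
have mA : measurable A.
  rewrite -[X in measurable X]setTI; apply: emeasurable_fun_o_infty => //.
  exact/measurable_EFinP.
have Ag x : A x -> (expR t * r)%:E < g x.
  rewrite /A /= -EFinM -EFinD !lte_fin -ltrBrDl => fx.
  have e0 : (0 <= expR (t / p) * r `^ p^-1)%R.
    by rewrite mulr_ge0 ?expR_ge0 ?powR_ge0.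
  have -> : (expR t * r = (expR (t / p) * r `^ p^-1) `^ p)%R.
    rewrite powRM ?expR_ge0 ?powR_ge0// -powRrM mulVf ?gt_eqF// powRr1//.
    by rewrite -expRM mulfVK ?gt_eqF.
  by rewrite gt0_ltr_powR ?nnegrE// ?le_max ?lexx ?orbT// lt_max fx.
have gA : (expR t * r)%:E * P A <= r%:E.
  apply: le_trans gv; rewrite -integral_cst//.
  apply: (@le_trans _ _ (\int[P]_(x in A) g x)).
    apply: ge0_le_integral => //.
    - by move=> x _; rewrite lee_fin mulr_ge0 ?expR_ge0.
    - exact: measurable_funTS.
    - by move=> x Ax; exact/ltW/Ag.
  exact: ge0_subset_integral.
(* Markov's inequality can be divided by [r] only when [r] is positive. If [r = 0], then [g]
   vanishes almost everywhere but is positive on [A], so [A] is null. *)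
have [r00|rN0] := eqVneq r 0%R; last first.
  have rp : (0 < r)%R by rewrite lt_neqAle eq_sym rN0.
  move: gA; rewrite mulrC EFinM -muleA -[leRHS]mule1 lee_pmul2l ?lte_fin//.
  rewrite expRN -lee_pdivlMl ?expR_gt0//.
  by rewrite mule1.
suff -> : P A = 0 by rewrite lee_fin expR_ge0.
have /(ae_eq_integral_abs P measurableT mg) [N [mN N0 gN]] :
    \int[P]_x `|g x| = 0.
  under eq_integral do rewrite gee0_abs//.
  by apply/eqP; rewrite eq_le integral_ge0// andbT (le_trans gv)// r00.
apply: (subset_measure0 mA mN _ N0) => x Ax; apply: gN => /(_ I) /= gx0.
by have := Ag x Ax; rewrite gx0 r00 mulr0 ltxx.
Qed.

(** Puts the coupling [Y = F X] among those over which the infimum in (i) is taken, because the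
    positive part is at most the absolute value. *)
Lemma admissible_kdirac (R : realType) (d : nat)
    (mu : probability (Rvec R d) R) (F : Rvec R d -> R)
    (mF : measurable_fun [set: Rvec R d] F) (q : R) : (1 <= q)%R ->
  \int[mu]_x ((`|F x| `^ q)%R)%:E < +oo ->
  admissible mu (kdirac (Y := measurableTypeR R) mF : cond_distr R d).
Proof.
move=> q1 Fq; exists q => //; rewrite pos_moment_kdirac.
apply: le_lt_trans Fq; apply: ge0_le_integral => //.
- by move=> x _; rewrite lee_fin powR_ge0.
- exact: measurable_pos_part.
- apply/measurable_EFinP; apply: (measurableT_comp (measurable_powR q)).
  exact: measurableT_comp.
move=> x _; rewrite lee_fin subr0 ge0_ler_powR ?nnegrE ?le_max ?lexx ?orbT//.
  exact: le_trans ler01 q1.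
by rewrite ge_max ler_norm normr_ge0.
Qed.

Theorem lemma2 (R : realType) (d : nat) (disp : measure_display)
    (Omega : measurableType disp) (P : probability Omega R)
    (X : {RV P >-> Rvec R d})
    (F : Rvec R d -> R) (mF : measurable_fun [set: Rvec R d] F)
    (hF : exists2 q : R, (1 <= q)%R & 'E_P[fun w => (`|F (X w)| `^ q)%R] < +oo) :
  [/\
    forall p : R, (1 <= p)%R ->
      'E_P[fun w => (`|F (X w)| `^ p)%R] < +oo ->
      'E_P[fun w => ((Num.max (F (X w)) 0) `^ p)%R] `^ (p^-1)%R =
      ereal_inf
        [set mule_top (pos_moment (distribution P X) K 0 p `^ (p^-1)%R)
                      (nu (distribution P X) F K `^ (p^-1)%R)
        | K in [set K : cond_distr R d | admissible (distribution P X) K]],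
    forall t : R, (0 <= t)%R ->
      P [set w | (F (X w))%:E <=
        ereal_inf
          [set v | exists (K : cond_distr R d) (b p : R),
            [/\ admissible (distribution P X) K, (1 <= p)%R &
              v = b%:E + (expR (t / p))%:E *
                  mule_top (pos_moment (distribution P X) K b p `^ (p^-1)%R)
                           (nu (distribution P X) F K `^ (p^-1)%R)]]]
      >= (1 - expR (- t))%:E
  & forall K : cond_distr R d, admissible (distribution P X) K ->
    forall s : R,
      P [set w | (s <= F (X w))%R] <=
      mule_top (nu (distribution P X) F K)
               (joint_law (distribution P X) K [set xy | (s <= xy.2)%R])].

Proof.
set mu := distribution P X.
have EP (b p : R) : \int[P]_w ((Num.max (F (X w) - b) 0 `^ p)%R)%:E =
    \int[mu]_x ((Num.max (F x - b) 0 `^ p)%R)%:E.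
  rewrite /mu ge0_integral_distribution//; first exact: measurable_pos_part.
  by move=> x; rewrite lee_fin powR_ge0.
have [q q1 Fq] := hF.
have admF : admissible mu (kdirac (Y := measurableTypeR R) mF : cond_distr R d).
  apply: (admissible_kdirac mF q1); move: Fq; rewrite unlock /mu.
  rewrite ge0_integral_distribution//.
  apply/measurable_EFinP; apply: (measurableT_comp (measurable_powR q)).
  exact: measurableT_comp.
have mFX : measurable_fun [set: Omega] (F \o X) by exact: measurableT_comp.
have mule_topE K b p : (1 <= p)%R ->
    mule_top (pos_moment mu K b p `^ p^-1) (nu mu F K `^ p^-1) =
    mule_top (pos_moment mu K b p) (nu mu F K) `^ p^-1.
  move=> p1; apply: mule_top_poweR.
  - by rewrite invr_gt0 (lt_le_trans ltr01).
  - rewrite /pos_moment unlock; apply: integral_ge0 => x _.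
    by rewrite lee_fin powR_ge0.
  - exact: le_trans lee01 (nu_ge1 _ _ _).
split.
- move=> p p1 _; have p0 : (0 <= p)%R := le_trans ler01 p1.
  (* Writing [F x - 0] matches the moments of [Y - b] at [b = 0]. *)
  rewrite [X in X `^ _](_ : _ = \int[mu]_x ((Num.max (F x - 0) 0 `^ p)%R)%:E).
    apply/eqP; rewrite eq_le; apply/andP; split.
      apply: le_ereal_inf_tmp => _ [K _ <-]; rewrite mule_topE//.
      apply: gt0_ler_poweR; rewrite ?invr_ge0//.
      + rewrite in_itv/= leey andbT; apply: integral_ge0 => x _.
        by rewrite lee_fin powR_ge0.
      + rewrite in_itv/= leey andbT.
        apply: le_trans (pos_moment_ge _ mF _ _ p0).
        by apply: integral_ge0 => x _; rewrite lee_fin powR_ge0.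
      + exact: pos_moment_ge.
    (* The coupling [Y = F X] attains the infimum, since its [nu] is 1. *)
    apply: ereal_inf_lbound; exists (kdirac (Y := measurableTypeR R) mF) => //.
    by rewrite mule_topE// nu_kdirac mule_topx1 pos_moment_kdirac.
  rewrite unlock -EP; by apply: eq_integral => w _; rewrite subr0.
- move=> t t0; set c := ereal_inf _.
  have mE : measurable [set w | c < (F (X w))%:E].
    rewrite -[X in measurable X]setTI; apply: emeasurable_fun_o_infty => //.
    exact/measurable_EFinP.
  (* It suffices to bound the complementary event by [expR (- t)], first for each candidate bound
     and then for their infimum [c]. *)
  rewrite (_ : [set w | _] = ~` [set w | c < (F (X w))%:E]); last first.
    by apply/seteqP; split => w /=; rewrite leNgt => /negP.
  rewrite probability_setC// EFinB leeB//.
  apply: measure_ereal_inf_lt.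
  + exact/measurable_EFinP.
  + by rewrite lee_fin expR_ge0.
  move=> _ [K [b [p [_ p1 ->]]]]; rewrite mule_topE//.
  have p0 : (0 < p)%R := lt_le_trans ltr01 p1.
  apply: measure_gt_pos_part => //; rewrite EP.
  by apply: pos_moment_ge => //; exact: ltW.
- move=> K _ s.
  have ms : measurable [set x | (s <= F x)%R].
    rewrite -[X in measurable X]setTI.
    by apply: measurable_fun_le => //.
  rewrite [leLHS](_ : _ = mu [set x | (s <= F x)%R])//.
  rewrite /mule_top; case: ifPn => [_|]; first by rewrite leey.
  rewrite negb_or => /andP[nuoo _].
  apply: (le_trans (measure_le_nu_joint_law mF (K := K) ms _)).
    by rewrite lt_neqAle nuoo leey.
  (* The event [s <= F X <= Y] is contained in [s <= Y]. *)
  rewrite lee_wpmul2l ?(le_trans lee01 (nu_ge1 _ _ _))// le_measure ?inE//.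
  - apply: measurableI; last exact: measurable_epigraph.
    by rewrite -[X in measurable X]setTI; exact: measurable_fst.
  - by rewrite -[X in measurable X]setTI; apply: measurable_fun_le.
  - by move=> xy [/= sF]; exact: le_trans.
Qed.
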